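(* Let $\Gamma=\langle\alpha,\beta\rangle$ be a numerical semigroup, where $\alpha<\beta$ are coprime positive integers, and suppose that $\alpha$ and $\beta$ are odd. Then, counted up to isomorphism, for each $\ell=0,\ldots,\lfloor\frac{\alpha}{2}\rfloor$ there are exactly \[ \binom{\lfloor\frac{\alpha}{2}\rfloor}{\ell}\binom{\lfloor\frac{\beta}{2}\rfloor}{\ell} \] selfdual $\Gamma$-semimodules with $2\ell+1$ (minimal) generators. In total there are \[ \binom{\lfloor\frac{\alpha}{2}\rfloor+\lfloor\frac{\beta}{2}\rfloor}{\lfloor\frac{\alpha}{2}\rfloor} \] isomorphism classes of selfdual $\Gamma$-semimodules.
   Context: Here $\mathbb{N}=\{0,1,2,\ldots\}$. A numerical semigroup $\Gamma$ is a submonoid of $(\mathbb{N},+)$ with finite complement in $\mathbb{N}$; $\langle\alpha,\beta\rangle=\{r\alpha+s\beta : r,s\in\mathbb{N}\}$. A $\Gamma$-semimodule is a non-empty subset $\Delta\subseteq\mathbb{Z}$ that is bounded below and satisfies $\Delta+\Gamma\subseteq\Delta$. A system of generators of $\Delta$ is a subset $\mathcal{E}\subseteq\Delta$ with $\bigcup_{x\in\mathcal{E}}(x+\Gamma)=\Delta$; every $\Gamma$-semimodule has a unique minimal system of generators, which is finite, and ''number of generators'' means its cardinality. A map $f:\Delta\to\Delta'$ of $\Gamma$-semimodules is a homomorphism if $f(\gamma+x)=\gamma+f(x)$ for all $\gamma\in\Gamma$, $x\in\Delta$; $\Delta$ and $\Delta'$ are isomorphic if there is a bijective homomorphism between them,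 equivalently $\Delta'=\Delta+c$ for some $c\in\mathbb{Z}$. The dual of $\Delta$ is $\Delta^*=\{c\in\mathbb{Z} : c+\Delta\subseteq\Gamma\}$, and $\Delta$ is called selfdual if $\Delta^*\cong\Delta$. *)

(* Defs.v *)
From mathcomp Require Import all_boot all_order all_algebra.
From mathcomp Require Import classical_sets functions cardinality.
From mathcomp Require Import zify.

Set Implicit Arguments.
Unset Strict Implicit.
Unset Printing Implicit Defensive.

Import Order.TTheory GRing.Theory Num.Theory.

Local Open Scope classical_set_scope.
Local Open Scope card_scope.
Local Open Scope ring_scope.

Definition numerical_semigroup (G : set nat) : Prop :=
  [/\ G 0%N, (forall x y, G x -> G y -> G (x + y)%N) & finite_set (~` G)].

Definition semigroup2 (a b : nat) : set nat :=
  [set n | exists r s : nat, n = (r * a + s * b)%N].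

Definition semimodule (G : set nat) (D : set int) : Prop :=
  [/\ D !=set0, has_lbound D & forall x g, D x -> G g -> D (x + g%:Z)].

Definition generators (G : set nat) (D E : set int) : Prop :=
  E `<=` D /\ \bigcup_(x in E) [set x + g%:Z | g in G] = D.

Definition minimal_generators (G : set nat) (D E : set int) : Prop :=
  generators G D E /\
  (forall E' : set int, generators G D E' -> E' `<=` E -> E' = E).

Definition has_num_generators (G : set nat) (n : nat) (D : set int) : Prop :=
  exists E : set int, minimal_generators G D E /\ E #= `I_n.

(* A map D -> D' is given by a function on int, of which only the values on D
   matter. *)
Definition semimodule_hom (G : set nat) (D D' : set int) (f : int -> int)
    : Prop :=
  set_fun D D' f /\ (forall g x, G g -> D x -> f (g%:Z + x) = g%:Z + f x).

Definition semimodule_iso (G : set nat) (D D' : set int) : Prop :=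
  exists f : int -> int, semimodule_hom G D D' f /\ set_bij D D' f.

Definition dual (G : set nat) (D : set int) : set int :=
  [set c | [set c + x | x in D] `<=` [set g%:Z | g in G]].

Definition selfdual (G : set nat) (D : set int) : Prop :=
  semimodule_iso G (dual G D) D.

Definition iso_class (G : set nat) (D : set int) : set (set int) :=
  [set D' | semimodule G D' /\ semimodule_iso G D D'].

Definition iso_classes (G : set nat) (P : set int -> Prop)
    : set (set (set int)) :=
  [set iso_class G D | D in [set D | semimodule G D /\ P D]].

Lemma semigroup2_numerical (a b : nat) :
  (0 < a)%N -> (0 < b)%N -> coprime a b ->
  numerical_semigroup (semigroup2 a b).
Proof.
move=> a0 b0 cab; split.
- by exists 0%N, 0%N.
- by move=> _ _ [r [s ->]] [r' [s' ->]]; exists (r + r')%N, (s + s')%N; lia.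
apply: (@sub_finite_set _ _ `I_(a * b)); last exact: finite_II.
move=> n /= nG; rewrite ltnNge; apply/negP => abn; apply: nG.
case: (egcdnP a b0) => u v; rewrite gcdnC (eqP cab) => uv _.
set s := (n * u %% a)%N.
have sa : (s < a)%N by rewrite ltn_mod.
have sbn : (s * b <= n)%N.
  by rewrite (leq_trans _ abn)// leq_mul2r (ltnW sa) orbT.
have : (a %| n - s * b)%N.
  rewrite -eqn_mod_dvd// /s modnMml -mulnA uv mulnDr muln1 mulnA.
  by rewrite modnMDl.
by case/dvdnP => r nr; exists r, s; rewrite -nr subnK.
Qed.

(* Main.v *)
Require Import Defs.
From mathcomp Require Import all_boot all_order all_algebra.
From mathcomp Require Import boolp classical_sets functions cardinality.
From mathcomp Require Import zify.

(** Write m = a./2 and n = b./2.  As a and b are coprime and a is odd, each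
integer is i * b + j * a for a unique pair with |i| <= m.  In these coordinates
a semimodule D is the region above a function h, namely j >= h i.  Closure
under b makes h weakly decreasing, and h extends to all i by
h (i + a) = h i - b.

Two facts turn duality into a reflection.  Isomorphic semimodules are
translates of each other ([semimodule_isoP]), and the semigroup is symmetric: g
belongs to it exactly when F - g does not, with F = a * b - a - b
([semigroup2_symmetric]).  Hence the dual of D is the complement of F - D, and D
is selfdual exactly when, for some N, the reflection x |-> N - x exchanges D and
its complement ([selfdualP]).  Such an N is unique, it is odd since the
reflection has no fixed point, and translation by c changes it by 2 * c; as a is
odd, each selfdual class has exactly one representative with N = - a.

For N = - a the reflection (i, j) |-> (- i, - 1 - j) says that h is odd.  So D
is given by the drops s_p = h p - h (p + 1) for 0 <= p < m, which are arbitrary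
natural numbers up to one constraint: the last drop of the period, from h m to
h (m + 1) = h (- m) - b, equals b - 2 * sumn s and has to be nonnegative, i.e.
sumn s <= n.  This is the bijection between sequences and classes
([staircase_inj], [symmetric_staircase], [card_selfdual_classes]).

The minimal generators of D are the corners of the staircase h, one for each
nonzero drop in a period.  The last drop is odd, so never zero, and every other
drop occurs twice by oddness of h: a sequence with l nonzero entries has
2 * l + 1 generators ([staircase_irreducibles]).

It remains to count sequences of m naturals with sum at most n: there are
'C(m + n, m) of them, and 'C(m, l) * 'C(n, l) with l nonzero entries, both by
recursion on the first entry ([size_bounded_seqs], [count_bounded_seqs]). *)

Set Implicit Arguments.
Unset Strict Implicit.
Unset Printing Implicit Defensive.

Import Order.TTheory GRing.Theory Num.Theory.

Local Open Scope classical_set_scope.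
Local Open Scope card_scope.
Local Open Scope ring_scope.

(** * Translates and isomorphisms *)

Definition shift (c : int) (D : set int) : set int := [set x | D (x - c)].

Lemma numerical_semigroup_cofinite (G : set nat) :
  numerical_semigroup G -> exists k, forall n, (k <= n)%N -> G n.
Proof.
case=> _ _ /finite_seqP[s Gs]; exists (\max_(x <- s) x).+1 => n kn.
apply: contrapT => nG; have : n \in s.
  by have : (~` G) n by []; rewrite Gs.
move=> ns; have := @leq_bigmax_seq _ s xpredT id n ns isT.
by rewrite leqNgt kn.
Qed.

(** A homomorphism f moves all elements of D by the same amount: since the
semigroup is cofinite, any x and x0 in D satisfy g + x = g0 + x0 for some g, g0
in it, and then g + f x = g0 + f x0. *)
Lemma semimodule_isoP (G : set nat) (D D' : set int) : numerical_semigroup G ->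
  semimodule_iso G D D' <-> exists c, D' = shift c D.
Proof.
move=> nsG; split; last first.
  case=> c ->; exists (fun x => x + c); split; first split.
  - by move=> x Dx; rewrite /shift /= addrK.
  - by move=> g x _ _; rewrite addrA.
  split.
  - by move=> x Dx; rewrite /shift /= addrK.
  - by move=> x y _ _ /addIr.
  - by move=> x Dx; exists (x - c) => //; rewrite subrK.
case=> f [[fD fhom] [_ _ fsurj]].
have [k Gk] := numerical_semigroup_cofinite nsG.
have [[x0 Dx0]|D0] := pselect (D !=set0); last first.
  exists 0; rewrite /shift; apply/seteqP; split => x /=.
    by move=> /fsurj[y Dy _]; case: D0; exists y.
  by rewrite subr0 => Dx; case: D0; exists x.
have fE x : D x -> f x = x + (f x0 - x0).
  move=> Dx.
  (* Both g and g0 are at least k, beyond which G has no gap. *)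
  pose g := (k + absz (x0 - x)%R)%N; pose g0 := absz (g%:Z + x - x0)%R.
  have g0E : g0%:Z = g%:Z + x - x0 by rewrite /g0 /g; lia.
  have Gg : G g by apply: Gk; rewrite /g; lia.
  have Gg0 : G g0 by apply: Gk; rewrite /g in g0E; lia.
  have e1 := fhom _ _ Gg Dx; have e2 := fhom _ _ Gg0 Dx0.
  have e : g%:Z + x = g0%:Z + x0 by lia.
  by rewrite e e2 in e1; lia.
exists (f x0 - x0); apply/seteqP; split => y.
  move=> /fsurj[x Dx <-]; rewrite /shift /= fE //.
  by have -> : x + (f x0 - x0) - (f x0 - x0) = x by lia.
rewrite /shift /= => Dx; have := fD _ Dx; rewrite fE //.
by have -> : y - (f x0 - x0) + (f x0 - x0) = y by lia.
Qed.

Lemma shift_shift c e D : shift c (shift e D) = shift (c + e) D.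
Proof.
apply/seteqP; split => x; rewrite /shift /=.
  by have -> : x - c - e = x - (c + e) by lia.
by have -> : x - c - e = x - (c + e) by lia.
Qed.

Lemma shift_semimodule G c D : semimodule G D -> semimodule G (shift c D).
Proof.
case=> [[x Dx] [l lD] DG]; split.
- by exists (x + c); rewrite /shift /= addrK.
- by exists (l + c) => y /lD; lia.
- by move=> y g Dy Gg; rewrite /shift /= addrAC; apply: DG.
Qed.

(** A nonzero period would produce elements below the lower bound. *)
Lemma shift_fixed_eq0 G c D : semimodule G D ->
  (forall x, D x -> D (x + c)) -> (forall x, D x -> D (x - c)) -> c = 0.
Proof.
case=> [[x Dx] [l lD] _] Dp Dm.
have Pk k : D (x + c * k%:Z).
  elim: k => [|k]; first by rewrite mulr0 addr0.
  by move=> /Dp; have -> : x + c * k%:Z + c = x + c * k.+1%:Z by lia.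
have Mk k : D (x - c * k%:Z).
  elim: k => [|k]; first by rewrite mulr0 subr0.
  by move=> /Dm; have -> : x - c * k%:Z - c = x - c * k.+1%:Z by lia.
have := lD _ (Pk (absz (x - l)%R).+1); have := lD _ (Mk (absz (x - l)%R).+1).
by have := lD _ Dx; nia.
Qed.

(** * Minimal generators *)

(** These are the elements that any generating set must contain, because only
g = 0 reaches them. *)
Definition irreducibles (G : set nat) (D : set int) : set int :=
  [set x | D x /\ forall g, G g -> D (x - g%:Z) -> g = 0%N].

(** Irreducible elements also suffice to generate: an element that is not
irreducible is g more than a smaller one, and D is bounded below.  So they form
the least generating set, hence the only minimal one. *)
Lemma has_num_generatorsP (G : set nat) (D : set int) n :
  numerical_semigroup G -> semimodule G D ->
  has_num_generators G n D <-> irreducibles G D #= `I_n.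
Proof.
move=> [G0 GD _] [_ [l lD] DG].
have irr_gen : generators G D (irreducibles G D).
  split=> [x []//|]; apply/seteqP; split => [x [y [Dy _]] [g Gg <-]|x].
    exact: DG.
  have [k] := ubnP (absz (x - l)%R); elim: k x => // k IH x xk Dx.
  have [irrx|] := pselect (irreducibles G D x).
    by exists x => //; exists 0%N => //; rewrite addr0.
  move=> /not_andP[//|/existsNP[g /not_implyP[Gg /not_implyP[Dxg g0]]]].
  have /IH/(_ Dxg)[y irry [h Gh yh]] : (absz (x - g%:Z - l)%R < k)%N.
    have := lD _ Dx; have := lD _ Dxg; lia.
  exists y => //; exists (h + g)%N; first exact: GD.
  by rewrite PoszD addrA yh subrK.
have irr_min E : generators G D E -> irreducibles G D `<=` E.
  move=> [ED EG] x [Dx irrx]; move: (Dx); rewrite -{1}EG => -[y Ey [g Gg yg]].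
  have g0 : g = 0%N.
    by apply: irrx Gg _; rewrite -yg addrK; apply: ED.
  by rewrite -yg g0 addr0.
split=> [[E [[EG Emin] En]]|irrn].
  by rewrite (Emin _ irr_gen (irr_min _ EG)).
exists (irreducibles G D); split => //; split => // E EG Eirr.
by apply/seteqP; split => //; apply: irr_min.
Qed.

Lemma shift_irreducibles G c D :
  irreducibles G (shift c D) = shift c (irreducibles G D).
Proof.
apply/seteqP; split => x; rewrite /irreducibles /shift /= => -[Dx irrx];
  split => // g Gg Dg; apply: irrx => //.
  by rewrite addrAC.
by rewrite addrAC.
Qed.

Lemma card_shift c D : shift c D #= D.
Proof.
have -> : shift c D = [set x + c | x in D].
  apply/seteqP; split => [x Dx|_ [x Dx <-]]; last by rewrite /shift /= addrK.
  by exists (x - c) => //; rewrite subrK.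
by apply: inj_card_eq => x y _ _ /addIr.
Qed.

Lemma shift_num_generators G n c D : numerical_semigroup G -> semimodule G D ->
  has_num_generators G n D -> has_num_generators G n (shift c D).
Proof.
move=> nsG mD; rewrite !has_num_generatorsP //; last exact: shift_semimodule.
by rewrite shift_irreducibles; apply: card_eq_trans; apply: card_shift.
Qed.

(** * Symmetry of the semigroup and duality *)

(** Bezout, with the coefficient of b reduced modulo a into any chosen window
of length a. *)
Lemma window_rep (a b : nat) (lo x : int) : (0 < a)%N -> coprime a b ->
  exists i j : int, [/\ lo <= i, i < lo + a%:Z & x = i * b%:Z + j * a%:Z].
Proof.
move=> a0 cab; have [u [v uv]] := Bezoutz a%:Z b%:Z.
have {uv} uv : u * a%:Z + v * b%:Z = 1 by rewrite uv /gcdz /= (eqP cab).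
pose q := divz (x * v - lo) a%:Z; pose r := modz (x * v - lo) a%:Z.
have e : x * v - lo = q * a%:Z + r := divz_eq _ _.
have r0 : 0 <= r by apply: modz_ge0; lia.
have ra : r < a%:Z by apply: ltz_pmod; lia.
exists (lo + r), (x * u + q * b%:Z); split; [lia|lia|].
have -> : lo + r = x * v - q * a%:Z by lia.
by rewrite -[LHS]mulr1 -uv; lia.
Qed.

Lemma window_rep_inj (a b : nat) (i j i' j' : int) : coprime a b ->
  `|i - i'| < a%:Z -> i * b%:Z + j * a%:Z = i' * b%:Z + j' * a%:Z ->
  i = i' /\ j = j'.
Proof.
move=> cab ii e.
have : (a%:Z %| (i - i') * b%:Z)%Z.
  by apply/dvdzP; exists (j' - j); lia.
rewrite Gauss_dvdzl; last by rewrite /coprimez /gcdz /=.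
move=> /dvdzP[q qe].
have q0 : q = 0 by nia.
have ie : i = i' by rewrite q0 mul0r in qe; lia.
split=> //; move: e; rewrite ie => /addrI.
by apply: mulIf; lia.
Qed.

(** Membership is read off the representation with 0 <= i < a, because trading a
copies of b for b copies of a can only increase the coefficient of a. *)
Lemma semigroup2_int (a b : nat) (i j : int) : coprime a b ->
  0 <= i -> i < a%:Z ->
  [set g%:Z | g in semigroup2 a b] (i * b%:Z + j * a%:Z) <-> 0 <= j.
Proof.
move=> cab i0 ia; split=> [[_ [r [s ->]] e]|j0]; last first.
  exists (absz j * a + absz i * b)%N; first by exists (absz j), (absz i).
  by lia.
(* Reduce the coefficient of b modulo a, and move the excess to a. *)
pose t := (s %/ a)%N; have se : s = (t * a + s %% a)%N := divn_eq _ _.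
have sa : (s %% a < a)%N by apply: ltn_pmod; lia.
have e2 : i * b%:Z + j * a%:Z = (s %% a)%N%:Z * b%:Z + (r + t * b)%N%:Z * a%:Z.
  by rewrite -e {1}se; lia.
by have [|_ ->] := window_rep_inj cab _ e2; lia.
Qed.

(** In the window 0 <= i < a, subtracting from the Frobenius number
a * b - a - b sends (i, j) to (a - 1 - i, - 1 - j). *)
Lemma semigroup2_symmetric (a b : nat) (x : int) : (0 < a)%N -> coprime a b ->
  [set g%:Z | g in semigroup2 a b] x <->
  ~ [set g%:Z | g in semigroup2 a b] (a%:Z * b%:Z - a%:Z - b%:Z - x).
Proof.
move=> a0 cab; have [i [j [i0 ia ->]]] := window_rep 0 x a0 cab.
have -> : a%:Z * b%:Z - a%:Z - b%:Z - (i * b%:Z + j * a%:Z) =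
   (a%:Z - 1 - i) * b%:Z + (- 1 - j) * a%:Z by lia.
rewrite !semigroup2_int //; lia.
Qed.

Definition symmetric_about (N : int) (D : set int) : Prop :=
  forall x, D x <-> ~ D (N - x).

(** With F the Frobenius number, c + x is a gap of the semigroup for some x in
D exactly when F - c - x is an element of it, i.e. when F - c is in
D plus the semigroup, which is D. *)
Lemma dual_semigroup2 (a b : nat) (D : set int) (c : int) :
  (0 < a)%N -> coprime a b -> semimodule (semigroup2 a b) D ->
  dual (semigroup2 a b) D c <-> ~ D (a%:Z * b%:Z - a%:Z - b%:Z - c).
Proof.
move=> a0 cab [_ _ DG]; split=> [cD Dc|nD _ [x Dx <-]].
  (* Otherwise the Frobenius number itself would be in the semigroup. *)
  have : [set g%:Z | g in semigroup2 a b] (a%:Z * b%:Z - a%:Z - b%:Z - 0).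
    by apply: cD; exists (a%:Z * b%:Z - a%:Z - b%:Z - c) => //; lia.
  have [sym0 _] := semigroup2_symmetric 0 a0 cab; apply: sym0.
  by exists 0%N => //; exists 0%N, 0%N.
apply/semigroup2_symmetric => // -[g Gg ge]; apply: nD.
have := DG _ _ Dx Gg.
by rewrite ge; have -> : x + (a%:Z * b%:Z - a%:Z - b%:Z - (c + x)) =
  a%:Z * b%:Z - a%:Z - b%:Z - c by lia.
Qed.

(** By the description of the dual, a translate of the dual of D is the
complement of a reflection of D. *)
Lemma selfdualP (a b : nat) (D : set int) :
  (0 < a)%N -> (0 < b)%N -> coprime a b -> semimodule (semigroup2 a b) D ->
  selfdual (semigroup2 a b) D <-> exists N, symmetric_about N D.
Proof.
move=> a0 b0 cab mD.
rewrite /selfdual semimodule_isoP; last exact: semigroup2_numerical.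
pose F : int := a%:Z * b%:Z - a%:Z - b%:Z.
split=> [[c Dc]|[N DN]].
  exists (F + c) => x; rewrite {1}Dc /shift /= dual_semigroup2 // -/F.
  by have -> : F - (x - c) = F + c - x by lia.
exists (N - F); apply/seteqP; split => x; rewrite /shift /=.
  move=> /DN nD; apply/dual_semigroup2 => //.
  by have -> : a%:Z * b%:Z - a%:Z - b%:Z - (x - (N - F)) = N - x
     by rewrite /F; lia.
move=> /dual_semigroup2 -/(_ a0 cab mD) nD; apply/DN.
by have <- : a%:Z * b%:Z - a%:Z - b%:Z - (x - (N - F)) = N - x
     by rewrite /F; lia.
Qed.

Lemma symmetric_shift N c D :
  symmetric_about N D -> symmetric_about (N + 2 * c) (shift c D).
Proof.
move=> DN x; rewrite /shift /= DN.
by have -> : N - (x - c) = N + 2 * c - x - c by lia.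
Qed.

(** If N = 2 * k, then k is fixed by the reflection and cannot be both in D and
outside. *)
Lemma symmetric_odd N D : symmetric_about N D -> exists k, N = 2 * k + 1.
Proof.
move=> DN; pose k := divz N 2; pose r := modz N 2.
have e : N = k * 2 + r := divz_eq _ _.
have r0 : 0 <= r by apply: modz_ge0; lia.
have r2 : r < 2 by apply: ltz_pmod; lia.
exists k; have [r1|r1] : r = 0 \/ r = 1 by lia.
  have [] := DN k; have -> : N - k = k by lia.
  move=> DnD nDD; have nD : ~ D k by move=> Dk; apply: (DnD Dk).
  by case: (nD (nDD nD)).
by lia.
Qed.

(** Composing two reflections gives a translation that preserves D. *)
Lemma symmetric_center_uniq G N N' D : semimodule G D ->
  symmetric_about N D -> symmetric_about N' D -> N = N'.
Proof.
move=> mD DN DN'; suff : N' - N = 0 by lia.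
have sub M M' : symmetric_about M D -> symmetric_about M' D ->
    forall x, D x -> D (x + (M' - M)).
  move=> DM DM' x Dx; apply/DM'.
  have -> : M' - (x + (M' - M)) = M - x by lia.
  exact: (DM x).1.
apply: (shift_fixed_eq0 mD) => x Dx; first exact: sub.
have -> : x - (N' - N) = x + (N - N') by lia.
exact: (sub N' N).
Qed.

(** * Staircases *)

(** The odd function with height 0 = 0 and with drops s_0, s_1, ... to the
right of 0. *)
Definition height (s : seq nat) (i : int) : int :=
  match i with
  | Posz p => - (sumn (take p s))%:Z
  | Negz p => (sumn (take p.+1 s))%:Z
  end.

Definition staircase (a b : nat) (s : seq nat) : set int :=
  [set x | exists i j : int,
     [/\ `|i| <= (a./2)%:Z, height s i <= j & x = i * b%:Z + j * a%:Z]].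

Lemma sumn_takeS (s : seq nat) p :
  sumn (take p.+1 s) = (sumn (take p s) + nth 0%N s p)%N.
Proof.
have [ps|sp] := ltnP p (size s).
  by rewrite (take_nth 0%N) // -cats1 sumn_cat /= addn0.
by rewrite nth_default // !take_oversize ?addn0 // leqW.
Qed.

Lemma heightN s i : height s (- i) = - height s i.
Proof. by case: i => [[|p]|p] //=; rewrite ?take0 ?opprK. Qed.

(** The drop from i to i + 1 is an entry of s.  For i = Negz p = - (p + 1), on
the left of 0, it is the entry number p. *)
Lemma heightD1 s i :
  height s i = height s (i + 1) +
    (if i is Negz p then nth 0%N s p else nth 0%N s (absz i))%:Z.
Proof.
case: i => [p|[|p]].
- have -> : Posz p + 1 = Posz p.+1 by lia.
  by rewrite /= sumn_takeS; lia.
- have -> : Negz 0 + 1 = Posz 0 by lia.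
  by rewrite /height sumn_takeS take0 [sumn [::]]/= oppr0 !add0r.
- have -> : Negz p.+1 + 1 = Negz p by lia.
  by rewrite /= (sumn_takeS _ p.+1); lia.
Qed.

Lemma mem_staircase (a b : nat) s (i j : int) : odd a -> coprime a b ->
  `|i| <= (a./2)%:Z ->
  staircase a b s (i * b%:Z + j * a%:Z) <-> height s i <= j.
Proof.
move=> oa cab im; split=> [[i' [j' [i'm hj e]]]|hj]; last by exists i, j.
by have [|-> ->] := window_rep_inj cab _ e => //; lia.
Qed.

Lemma balanced_rep (a b : nat) (x : int) : odd a -> coprime a b ->
  exists i j : int, `|i| <= (a./2)%:Z /\ x = i * b%:Z + j * a%:Z.
Proof.
move=> oa cab.
have [|i [j [i0 ia ->]]] := @window_rep a b (- (a./2)%:Z) x _ cab; first by lia.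
by exists i, j; split => //; lia.
Qed.

Lemma height_half (a : nat) s : size s = a./2 ->
  height s (a./2)%:Z = - (sumn s)%:Z.
Proof. by move=> <-; rewrite /= take_size. Qed.

(** The reflection sends (i, j) to (- i, - 1 - j), and height is odd. *)
Lemma staircase_symmetric (a b : nat) s : odd a -> coprime a b ->
  symmetric_about (- a%:Z) (staircase a b s).
Proof.
move=> oa cab x; have [i [j [im ->]]] := balanced_rep x oa cab.
have -> : - a%:Z - (i * b%:Z + j * a%:Z) = (- i) * b%:Z + (- 1 - j) * a%:Z.
  by lia.
rewrite !mem_staircase //; last by lia.
by rewrite heightN; lia.
Qed.

Lemma staircase_addl (a b : nat) s x : staircase a b s x ->
  staircase a b s (x + a%:Z).
Proof.
by move=> [i [j [im hj ->]]]; exists i, (j + 1); split => //; lia.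
Qed.

(** Adding b at the right end i = m of the window wraps around to i = - m and
j + b.  This stays above the staircase because the total drop across the window
is 2 * sumn s <= b. *)
Lemma staircase_addr (a b : nat) s x : odd a -> odd b ->
  size s = a./2 -> (sumn s <= b./2)%N ->
  staircase a b s x -> staircase a b s (x + b%:Z).
Proof.
move=> oa ob ss sb [i [j [im hj ->]]].
have [ilt|ige] := ltP i (a./2)%:Z.
  exists (i + 1), j; split; [lia| |lia].
  by move: hj; rewrite heightD1; lia.
have ie : i = (a./2)%:Z by lia.
exists (- (a./2)%:Z), (j + b%:Z); split; [lia| |].
  by move: hj; rewrite ie heightN height_half //; lia.
have ae : a%:Z = 2 * (a./2)%:Z + 1 by lia.
by rewrite ie ae; lia.
Qed.

Lemma staircase_semimodule (a b : nat) s : odd a -> odd b -> coprime a b ->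
  size s = a./2 -> (sumn s <= b./2)%N ->
  semimodule (semigroup2 a b) (staircase a b s).
Proof.
move=> oa ob cab ss sb; split.
- by exists 0; exists 0, 0; split => //=; rewrite take0.
- exists (- (a./2 * b + sumn s * a)%N%:Z) => x [i [j [im hj ->]]].
  have hs : - (sumn s)%:Z <= height s i.
    have le p : (sumn (take p s) <= sumn s)%N.
      by rewrite -{2}(cat_take_drop p s) sumn_cat leq_addr.
    by case: i {im hj} => p /=; have := le p; have := le p.+1; lia.
  have h1 : - (a./2)%:Z * b%:Z <= i * b%:Z by apply: ler_wpM2r; lia.
  have h2 : - (sumn s)%:Z * a%:Z <= j * a%:Z by apply: ler_wpM2r; lia.
  by lia.
move=> x _ Dx [r [t ->]].
have Dr : staircase a b s (x + (r * a)%N%:Z).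
  elim: r => [|r /staircase_addl]; first by rewrite mul0n addr0.
  by have -> : x + (r * a)%N%:Z + a%:Z = x + (r.+1 * a)%N%:Z by lia.
elim: t => [|t /(staircase_addr oa ob ss sb)]; first by rewrite addn0.
by have -> : x + (r * a + t * b)%N%:Z + b%:Z = x + (r * a + t.+1 * b)%N%:Z
  by lia.
Qed.

(** Membership of i * b + j * a determines the heights, and the entries of s
are their differences. *)
Lemma staircase_inj (a b : nat) s s' : odd a -> coprime a b ->
  size s = a./2 -> size s' = a./2 ->
  staircase a b s = staircase a b s' -> s = s'.
Proof.
move=> oa cab ss ss' e.
have hh p : (p <= a./2)%N -> sumn (take p s) = sumn (take p s').
  move=> pm; have pm' : `|p%:Z| <= (a./2)%:Z by lia.
  have h1 := mem_staircase s (height s p) oa cab pm'.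
  have h2 := mem_staircase s (height s' p) oa cab pm'.
  have h3 := mem_staircase s' (height s p) oa cab pm'.
  have h4 := mem_staircase s' (height s' p) oa cab pm'.
  rewrite -e in h3 h4; have := h3.1 (h1.2 (lexx _)).
  have := h2.1 (h4.2 (lexx _)); rewrite /=; lia.
apply: (@eq_from_nth _ 0%N); first by rewrite ss.
move=> p; rewrite ss => pm.
have := hh _ pm; rewrite !sumn_takeS hh; last exact: ltnW.
by lia.
Qed.

Lemma down_closed_cut (P : int -> Prop) (n : nat) :
  P 0 -> (forall j, P j -> P (j - 1)) -> ~ P n.+1%:Z ->
  exists k : nat, (k <= n)%N /\ forall j : int, P j <-> j <= k%:Z.
Proof.
move=> P0 Pd Pn.
have Pdn (k : nat) j : P j -> P (j - k%:Z).
  move=> Pj; elim: k => [|k /Pd]; first by rewrite subr0.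
  by have -> : j - k%:Z - 1 = j - k.+1%:Z by lia.
have exP : exists k : nat, `[< P k%:Z >] by exists 0%N; apply/asboolP.
have ub (k : nat) : `[< P k%:Z >] -> (k <= n)%N.
  move=> /asboolP Pk; rewrite leqNgt; apply/negP => nk; apply: Pn.
  have := Pdn (k - n.+1)%N _ Pk.
  by have -> : k%:Z - (k - n.+1)%N%:Z = n.+1%:Z by lia.
have [k /asboolP Pk kmax] := ex_maxnP exP ub.
exists k; split; first by apply: ub; apply/asboolP.
move=> j; split => [Pj|jk].
  have [j0|j0] := ltP j 0; first by lia.
  have ej : Posz (absz j) = j by lia.
  have /kmax : `[< P (absz j)%:Z >] by apply/asboolP; rewrite ej.
  by lia.
have := Pdn (absz (k%:Z - j)) _ Pk.
by have -> : k%:Z - (absz (k%:Z - j))%:Z = j by lia.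
Qed.

(** For each p <= m, the j with p * b - j * a in D form a cut at some u p.
These u are the partial sums of the sequence s that is sought; reflection then
fixes D on the other half of the window. *)
Lemma symmetric_staircase (a b : nat) (D : set int) :
  odd a -> odd b -> coprime a b -> semimodule (semigroup2 a b) D ->
  symmetric_about (- a%:Z) D ->
  exists s, [/\ size s = a./2, (sumn s <= b./2)%N & D = staircase a b s].
Proof.
move=> oa ob cab [_ _ DG] Da.
have DA x (k : nat) : D x -> D (x + k%:Z * a%:Z).
  move=> Dx; have -> : k%:Z * a%:Z = (k * a + 0 * b)%N%:Z by lia.
  by apply: DG => //; exists k, 0%N.
have DB x (k : nat) : D x -> D (x + k%:Z * b%:Z).
  move=> Dx; have -> : k%:Z * b%:Z = (0 * a + k * b)%N%:Z by lia.
  by apply: DG => //; exists 0%N, k.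
have D0 : D 0.
  apply/Da => nD; have := DA _ 1%N nD.
  have -> : - a%:Z - 0 + 1%:Z * a%:Z = 0 by lia.
  by move/Da.
have ae : a%:Z = 2 * (a./2)%:Z + 1 by lia.
have be : b%:Z = 2 * (b./2)%:Z + 1 by lia.
have cut (p : nat) : exists k : nat, (p <= a./2)%N ->
    (k <= b./2)%N /\ forall j : int, D (p%:Z * b%:Z - j * a%:Z) <-> j <= k%:Z.
  have [pm|pm] := leqP p a./2; last by exists 0%N.
  case: (@down_closed_cut (fun j => D (p%:Z * b%:Z - j * a%:Z)) b./2).
  - by have := DB _ p D0; rewrite mul0r subr0 add0r.
  - move=> j /(DA _ 1%N).
    by have -> : p%:Z * b%:Z - j * a%:Z + 1%:Z * a%:Z =
      p%:Z * b%:Z - (j - 1) * a%:Z by lia.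
  (* Move the bad point to i = m, j = - (n + 1): adding b once more gives its
     own reflection, since a = 2 m + 1 and b = 2 n + 1. *)
  - move=> /(DB _ (a./2 - p)%N); set x := (X in D X) => Dx.
    have xe : x = (a./2)%:Z * b%:Z - (b./2).+1%:Z * a%:Z.
      by rewrite /x -subzn //; lia.
    move: (Dx) => /Da; apply.
    have -> : - a%:Z - x = x + 1%N%:Z * b%:Z.
      by rewrite xe ae be; lia.
    exact: DB.
  by move=> k kP; exists k.
have [u uP] := choice cut.
have u0 : u 0%N = 0%N.
  have [_ h] := uP 0%N isT; have := (h 1).
  have -> : 0%:Z * b%:Z - 1 * a%:Z = - a%:Z - 0 by lia.
  case: (u 0%N) => // k hk; case: ((Da 0).1 D0).
  by apply: hk.2; lia.
have uS p : (p < a./2)%N -> (u p <= u p.+1)%N.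
  move=> pm; have [_ h] := uP _ (ltnW pm); have [_ h'] := uP _ pm.
  have := (h (u p)).2 (lexx _) => /(DB _ 1%N).
  have -> : p%:Z * b%:Z - (u p)%:Z * a%:Z + 1%:Z * b%:Z =
    p.+1%:Z * b%:Z - (u p)%:Z * a%:Z by lia.
  by move=> /h'.
(* Truncated subtraction is exact here, as u is weakly increasing. *)
pose s := mkseq (fun p => u p.+1 - u p)%N a./2.
have su p : (p <= a./2)%N -> sumn (take p s) = u p.
  elim: p => [|p IH] pm; first by rewrite take0 u0.
  by rewrite sumn_takeS IH ?(ltnW pm) // nth_mkseq // subnKC // uS.
have ss : size s = a./2 by rewrite size_mkseq.
exists s; split => //.
  by rewrite -(take_size s) ss su //; case: (uP _ (leqnn a./2)).
have Dpos (p : nat) j : (p <= a./2)%N ->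
    D (p%:Z * b%:Z + j * a%:Z) <-> - (u p)%:Z <= j.
  move=> pm; have [_ h] := uP _ pm; have := h (- j).
  have -> : p%:Z * b%:Z - - j * a%:Z = p%:Z * b%:Z + j * a%:Z by lia.
  by move=> ->; lia.
apply/seteqP; suff DE x : D x <-> staircase a b s x by split => x /DE.
have [i [j [im ->]]] := balanced_rep x oa cab.
rewrite mem_staircase //; case: i im => p pm.
  by rewrite Dpos /= ?su; lia.
rewrite Da; have -> : - a%:Z - (Negz p * b%:Z + j * a%:Z) =
  p.+1%:Z * b%:Z + (- 1 - j) * a%:Z by lia.
rewrite Dpos /= ?su; lia.
Qed.

(** * Generators of a staircase *)

Lemma card_uniq_seq (T : eqType) (s : seq T) :
  uniq s -> [set` s] #= `I_(size s).
Proof.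
elim: s => [_|x s IH /= /andP[xs us]].
  have -> : [set` [::]] = set0 :> set T by apply/seteqP; split.
  by rewrite II0.
apply/eq_cardSP; exists x; first by rewrite /= inE eqxx.
have -> : [set` x :: s] `\ x = [set` s]; last exact: IH.
apply/seteqP; split => y /=; rewrite inE.
  by case=> /orP[/eqP ->|].
move=> ys; rewrite ys orbT; split => // yx.
by rewrite -yx ys in xs.
Qed.

Lemma irreducibles_semigroup2 (a b : nat) (D : set int) (x : int) :
  (0 < a)%N -> (0 < b)%N -> semimodule (semigroup2 a b) D ->
  irreducibles (semigroup2 a b) D x <->
  D x /\ ~ D (x - a%:Z) /\ ~ D (x - b%:Z).
Proof.
move=> a0 b0 [_ _ DG]; split=> [[Dx irrx]|[Dx [na nb]]].
  split=> //; split=> /irrx h.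
  - by have : a = 0%N by [apply: h; exists 1%N, 0%N; lia]; lia.
  - by have : b = 0%N by [apply: h; exists 0%N, 1%N; lia]; lia.
split=> // _ [[|r] [[|t] ->]] Dg.
- by [].
- case: nb; have := DG _ (t * b)%N Dg.
  have -> : x - (0 * a + t.+1 * b)%N%:Z + (t * b)%N%:Z = x - b%:Z by lia.
  by apply; exists 0%N, t; lia.
- case: na; have := DG _ (r * a)%N Dg.
  have -> : x - (r.+1 * a + 0 * b)%N%:Z + (r * a)%N%:Z = x - a%:Z by lia.
  by apply; exists r, 0%N; lia.
- case: na; have := DG _ (r * a + t.+1 * b)%N Dg.
  have -> : x - (r.+1 * a + t.+1 * b)%N%:Z + (r * a + t.+1 * b)%N%:Z =
     x - a%:Z by lia.
  by apply; exists r, t.+1; lia.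
Qed.

(** The indices i of the window |i| <= size s at which the staircase steps down
on arrival from i - 1.  The left end of the window is always one of them: the
drop into it is b - 2 * sumn s, which is positive when b is odd and
sumn s <= b./2. *)
Definition descents (s : seq nat) : seq int :=
  let P := [seq p <- iota 0 (size s) | (0 < nth 0 s p)%N] in
  - (size s)%:Z :: [seq p%:Z + 1 | p <- P] ++ [seq - p%:Z | p <- P].

Lemma size_descents s : size (descents s) = (2 * count (ltn 0) s + 1)%N.
Proof.
rewrite /descents /= size_cat !size_map size_filter.
suff : count (fun p => 0 < nth 0 s p)%N (iota 0 (size s)) = count (ltn 0) s.
  by move=> ->; rewrite addnn mul2n addn1.
by rewrite -[in RHS](mkseq_nth 0%N s) count_map.
Qed.

Lemma mem_descents s i : `|i| <= (size s)%:Z ->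
  i \in descents s = (i == - (size s)%:Z) || (height s i < height s (i - 1)).
Proof.
move=> im; rewrite /descents inE; case: eqVneq => //= im'.
rewrite mem_cat [height s (i - 1)]heightD1 subrK.
set P := filter _ _.
have memP p : (p \in P) = (0 < nth 0 s p)%N.
  rewrite mem_filter mem_iota /= add0n.
  by have [_|sp] := ltnP p (size s); rewrite ?andbT // nth_default.
have [i0|i0] := leP i 0.
  have -> : (i \in [seq p%:Z + 1 | p <- P]) = false.
    by apply/negP => /mapP[p _ e]; lia.
  have -> : i = - (absz i)%:Z by lia.
  rewrite (mem_map (f := fun p : nat => - p%:Z)); last by move=> p q; lia.
  rewrite memP; have -> : - (absz i)%:Z - 1 = Negz (absz i) by lia.
  by lia.
have -> : (i \in [seq - p%:Z | p <- P]) = false.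
  by apply/negP => /mapP[p _ e]; lia.
rewrite orbF; case: i im im' i0 => // -[//|p] _ _ _.
have -> : Posz p.+1 = p%:Z + 1 by lia.
rewrite (mem_map (f := fun p : nat => p%:Z + 1)); last by move=> q q'; lia.
by rewrite memP addrK /=; lia.
Qed.

Lemma descents_bound s i : i \in descents s -> `|i| <= (size s)%:Z.
Proof.
rewrite /descents inE mem_cat => /orP[/eqP ->|]; first by lia.
by move=> /orP[] /mapP[p]; rewrite mem_filter mem_iota => h ->; lia.
Qed.

Lemma descents_uniq s : uniq (descents s).
Proof.
rewrite /descents /=; set P := filter _ _.
have uP : uniq P by rewrite filter_uniq // iota_uniq.
have Pb p : p \in P -> (p < size s)%N.
  by rewrite mem_filter mem_iota => /andP[_]; rewrite add0n.
rewrite cat_uniq !map_inj_uniq ?uP /=; try by move=> p q; lia.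
rewrite andbT; apply/andP; split.
  by rewrite mem_cat; apply/negP => /orP[] /mapP[p /Pb ps]; lia.
by apply/hasPn => _ /mapP[p _ ->]; apply/negP => /mapP[q _]; lia.
Qed.

(** A point (i, j) is a corner of the staircase when it lies on it, but
neither (i, j - 1) nor (i - 1, j) does; here h and h' stand for the heights at
i and i - 1. *)
Lemma corner_height (h h' j : int) :
  h <= j /\ ~ h <= j - 1 /\ ~ h' <= j <-> j = h /\ h < h'.
Proof. by split=> [[? [? ?]]|[-> ?]]; split; lia. Qed.

(** Irreducible elements are the corners (i, height s i), for i in
descents s. *)
Lemma staircase_irreducibles (a b : nat) s : odd a -> odd b -> coprime a b ->
  size s = a./2 -> (sumn s <= b./2)%N ->
  irreducibles (semigroup2 a b) (staircase a b s)
    #= `I_(2 * count (ltn 0) s + 1)%N.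
Proof.
move=> oa ob cab ss sb.
have mD := staircase_semimodule oa ob cab ss sb.
pose f (i : int) := i * b%:Z + height s i * a%:Z.
rewrite -size_descents.
apply: card_eq_trans (card_uniq_seq (descents_uniq s)).
have -> : irreducibles (semigroup2 a b) (staircase a b s) =
    f @` [set` descents s]; last first.
  apply: inj_card_eq => i j; rewrite !inE /= => /descents_bound im.
  by move=> /descents_bound jm /window_rep_inj -/(_ cab) []; lia.
have irrP (i j : int) : `|i| <= (a./2)%:Z ->
    irreducibles (semigroup2 a b) (staircase a b s) (i * b%:Z + j * a%:Z) <->
    j = height s i /\ i \in descents s.
  move=> im; rewrite irreducibles_semigroup2 //; try by lia.
  rewrite mem_staircase //.
  have -> : i * b%:Z + j * a%:Z - a%:Z = i * b%:Z + (j - 1) * a%:Z by lia.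
  rewrite mem_staircase // mem_descents ?ss //.
  have [->|im'] /= := eqVneq i (- (a./2)%:Z); last first.
    have -> : i * b%:Z + j * a%:Z - b%:Z = (i - 1) * b%:Z + j * a%:Z by lia.
    rewrite mem_staircase //; last by lia.
    exact: corner_height.
  (* At the left end, i - 1 wraps around to the right end of the window. *)
  have ae : a%:Z = 2 * (a./2)%:Z + 1 by lia.
  have -> : - (a./2)%:Z * b%:Z + j * a%:Z - b%:Z =
      (a./2)%:Z * b%:Z + (j - b%:Z) * a%:Z by rewrite ae; lia.
  rewrite mem_staircase //.
  rewrite heightN height_half //.
  by split=> [[? [? ?]]|[-> ?]]; split; lia.
apply/seteqP; split=> [x irrx|_ [i /= si <-]].
  have [i [j [im e]]] := balanced_rep x oa cab.
  by move: irrx; rewrite e => /irrP -/(_ im) [-> si]; exists i.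
by apply/irrP => //; have := descents_bound si; rewrite ss.
Qed.

(** * Sequences of bounded sum *)

Fixpoint bounded_seqs (m n : nat) : seq (seq nat) :=
  if m is m'.+1 then
    [seq d :: s | d <- iota 0 n.+1, s <- bounded_seqs m' (n - d)]
  else [:: [::]].

Lemma mem_bounded_seqs m n s :
  (s \in bounded_seqs m n) = (size s == m) && (sumn s <= n)%N.
Proof.
elim: m n s => [|m IH] n s; first by case: s.
apply/allpairsPdep/andP => [[d [t]]|].
  rewrite mem_iota IH => -[dn /andP[/eqP <- tn] ->] /=; split => //; lia.
case: s => [[]//|d t] [/eqP[sm] dn]; exists d, t.
by rewrite mem_iota IH sm eqxx; split => //; move: dn => /=; lia.
Qed.

Lemma bounded_seqs_uniq m n : uniq (bounded_seqs m n).
Proof.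
elim: m n => [//|m IH] n.
apply: (@allpairs_uniq_dep _ (fun=> seq nat)) => [|d _|].
- exact: iota_uniq.
- exact: IH.
by move=> [d s] [d' s'] _ _ [-> ->].
Qed.

Lemma count_bounded_seqsS (P : pred (seq nat)) m n :
  count P (bounded_seqs m.+1 n) =
  \sum_(d < n.+1)
    count [pred s | P (nat_of_ord d :: s)] (bounded_seqs m (n - d)).
Proof.
rewrite -(big_mkord xpredT
  (fun d => count [pred s | P (d :: s)] (bounded_seqs m (n - d)))).
have -> : bounded_seqs m.+1 n = flatten
  [seq [seq d :: s | s <- bounded_seqs m (n - d)] | d <- iota 0 n.+1] by [].
rewrite count_flatten -map_comp sumnE big_map /index_iota subn0.
by apply: eq_bigr => d _; rewrite /= count_map.
Qed.

(** Splitting on the first entry gives the hockey-stick sum of the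
'C(m + d, m) for d <= n. *)
Lemma size_bounded_seqs m n : size (bounded_seqs m n) = 'C(m + n, m).
Proof.
elim: m n => [|m IH] n; first by rewrite bin0.
rewrite -count_predT count_bounded_seqsS.
(* Summing over the remaining budget n - d instead of the first entry d. *)
rewrite (reindex_inj rev_ord_inj) /=.
under eq_bigr => d _ do rewrite count_predT IH subKn -1?ltnS //.
elim: n => [|n IHn]; first by rewrite big_ord_recl big_ord0 /= !addn0 !binn.
by rewrite big_ord_recr /= IHn [in RHS]addSn binS addSnnS.
Qed.

(** In length m + 1, a zero first entry contributes 'C(m, l) * 'C(n, l).  For
l > 0, the nonzero ones contribute 'C(m, l - 1) times the hockey-stick sum of
the 'C(k, l - 1) for k < n, which is 'C(n, l). *)
Lemma count_bounded_seqs m n l :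
  count (fun s => count (ltn 0) s == l) (bounded_seqs m n) =
  ('C(m, l) * 'C(n, l))%N.
Proof.
elim: m n l => [|m IH] n l.
  by case: l => [|l]; rewrite ?bin0 // bin_small.
rewrite count_bounded_seqsS big_ord_recl /= subn0 IH.
case: l => [|l].
  rewrite big1 ?addn0 ?bin0 // => d _.
  by rewrite (@eq_count _ _ pred0) ?count_pred0.
under eq_bigr => d _ do rewrite IH.
rewrite -big_distrr /= binS mulnDl; congr (_ + _ * _)%N.
elim: n {IH} => [|n IHn]; first by rewrite big_ord0.
rewrite big_ord_recl /= /bump /= subSS subn0 binS addnC -IHn.
by congr (_ + _)%N; apply: eq_bigr.
Qed.

(** * Classes of selfdual semimodules *)

(** Each class that satisfies P has exactly one representative that is
symmetric about - a, and this representative is a staircase.  It is stated for a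
property P of selfdual semimodules so that it gives both the total and the count
by number of generators. *)
Lemma card_selfdual_classes (a b : nat) (P : set int -> Prop)
    (p : pred (seq nat)) : odd a -> odd b -> coprime a b ->
  (forall D, P D -> selfdual (semigroup2 a b) D) ->
  (forall c D, semimodule (semigroup2 a b) D -> P D -> P (shift c D)) ->
  (forall s, size s = a./2 -> (sumn s <= b./2)%N ->
     P (staircase a b s) <-> p s) ->
  iso_classes (semigroup2 a b) P #= `I_(count p (bounded_seqs a./2 b./2)).
Proof.
move=> oa ob cab Psd Psh Pp.
have nsG : numerical_semigroup (semigroup2 a b).
  by apply: semigroup2_numerical => //; lia.
pose L := filter p (bounded_seqs a./2 b./2).
have LP s : s \in L -> [/\ size s = a./2, (sumn s <= b./2)%N & p s].
  by rewrite mem_filter mem_bounded_seqs => /and3P[? /eqP].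
have uL : uniq L by rewrite filter_uniq // bounded_seqs_uniq.
rewrite -size_filter; apply: card_eq_trans (card_uniq_seq uL).
have mL s : s \in L -> semimodule (semigroup2 a b) (staircase a b s).
  by move=> /LP[ss sb _]; apply: staircase_semimodule.
pose cl s := iso_class (semigroup2 a b) (staircase a b s).
have isoP := @semimodule_isoP _ _ _ nsG.
have -> : iso_classes (semigroup2 a b) P = cl @` [set` L]; last first.
  apply: inj_card_eq => s t; rewrite !inE /= => sL tL clst.
  have [ss _ _] := LP _ sL; have [st _ _] := LP _ tL.
  have : cl s (staircase a b t).
    by rewrite clst; split; [exact: mL|apply/isoP; exists 0; apply/seteqP;
      rewrite /shift; split => x /=; rewrite subr0].
  move=> [_ /isoP[c tc]]; apply: (staircase_inj oa cab ss st).
  have symt := @staircase_symmetric a b t oa cab.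
  have := symmetric_shift c (@staircase_symmetric a b s oa cab).
  rewrite -tc => /(symmetric_center_uniq (mL _ tL) symt) ac.
  have c0 : c = 0 by lia.
  by rewrite tc c0; apply/seteqP; rewrite /shift; split => x /=; rewrite subr0.
apply/seteqP; split=> [_ [D [mD PD] <-]|_ [s /= sL <-]]; last first.
  exists (staircase a b s) => //; split; first exact: mL.
  by have [ss sb ps] := LP _ sL; exact: (Pp s ss sb).2.
have /selfdualP -/(_ _ _ _ mD) [||//|N DN] := Psd _ PD; try by lia.
have [k Nk] := symmetric_odd DN.
(* With N = 2 k + 1, this is the translation with N + 2 c = - a. *)
pose c := - (k + (a./2)%:Z + 1).
have := symmetric_shift c DN; have -> : N + 2 * c = - a%:Z by lia.
move=> /(symmetric_staircase oa ob cab (shift_semimodule c mD)).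
move=> [s [ss sb Ds]]; exists s.
  rewrite /= mem_filter mem_bounded_seqs ss eqxx sb !andbT.
  by apply: (Pp s ss sb).1; rewrite -Ds; apply: Psh.
rewrite /cl -Ds; apply/seteqP; split=> D' [mD' /isoP[e ->]]; split => //.
- by rewrite shift_shift; apply/shift_semimodule.
- by apply/isoP; rewrite shift_shift; exists (e + c).
- by apply: shift_semimodule.
- by apply/isoP; exists (e - c); rewrite shift_shift subrK.
Qed.

Lemma selfdual_shift (a b : nat) (c : int) (D : set int) :
  (0 < a)%N -> (0 < b)%N -> coprime a b -> semimodule (semigroup2 a b) D ->
  selfdual (semigroup2 a b) D -> selfdual (semigroup2 a b) (shift c D).
Proof.
move=> a0 b0 cab mD; rewrite !selfdualP //; last exact: shift_semimodule.
by move=> [N DN]; exists (N + 2 * c); apply: symmetric_shift.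
Qed.

Lemma staircase_selfdual (a b : nat) s : odd a -> odd b -> coprime a b ->
  size s = a./2 -> (sumn s <= b./2)%N ->
  selfdual (semigroup2 a b) (staircase a b s).
Proof.
move=> oa ob cab ss sb; apply/selfdualP => //; try by lia.
  exact: staircase_semimodule.
by exists (- a%:Z); apply: staircase_symmetric.
Qed.

Theorem theorem5p2 (a b : nat) (a_gt0 : (0 < a)%N) (lt_ab : (a < b)%N)
    (co_ab : coprime a b) (odd_a : odd a) (odd_b : odd b) :
  (forall l : nat, (l <= a./2)%N ->
     iso_classes (semigroup2 a b)
       (fun D => selfdual (semigroup2 a b) D /\
                 has_num_generators (semigroup2 a b) (2 * l + 1)%N D)
     #= `I_('C(a./2, l) * 'C(b./2, l))%N) /\
  iso_classes (semigroup2 a b) (selfdual (semigroup2 a b))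
    #= `I_('C(a./2 + b./2, a./2))%N.
Proof.
have b_gt0 : (0 < b)%N by lia.
have nsG : numerical_semigroup (semigroup2 a b) by apply: semigroup2_numerical.
split=> [l _|]; last first.
  rewrite -size_bounded_seqs -count_predT; apply: card_selfdual_classes => //.
    by move=> c D; apply: selfdual_shift.
  by move=> s ss sb; split => // _; apply: staircase_selfdual.
rewrite -count_bounded_seqs; apply: card_selfdual_classes => //.
- by move=> D [].
- move=> c D mD [sD gD]; split; first exact: selfdual_shift.
  exact: shift_num_generators.
move=> s ss sb; have mD := staircase_semimodule odd_a odd_b co_ab ss sb.
have irr := staircase_irreducibles odd_a odd_b co_ab ss sb.
rewrite has_num_generatorsP //; split=> [[_ irr']|/eqP cs].
  have : `I_(2 * count (ltn 0) s + 1) #= `I_(2 * l + 1).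
    by apply: card_eq_trans irr'; rewrite card_eq_sym.
  by move=> /card_eq_II /eqP; rewrite eqn_add2r eqn_pmul2l.
by rewrite -cs; split => //; apply: staircase_selfdual.
Qed.
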